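(* Let $f:A\rightarrow B$ and $g:A\rightarrow C$ be two ring homomorphisms and let $J$ and $J'$ be ideals of $B$ and $C$, respectively, such that $f^{-1}(J)=g^{-1}(J')$; denote this common ideal of $A$ by $I_0$, and suppose that $I_0$ is a nil ideal of $A$. Then the ring $A\bowtie^{f,g}(J,J')$ is Nil$_{\ast}$-Noetherian if and only if the rings $f(A)+J$ and $g(A)+J'$ are Nil$_{\ast}$-Noetherian.
   Context: All rings are commutative with identity. An ideal $I$ of a ring $R$ is a nil ideal if every element of $I$ is nilpotent. A ring $R$ is Nil$_{\ast}$-Noetherian if every nil ideal of $R$ is finitely generated. For ring homomorphisms $f:A\to B$, $g:A\to C$ and ideals $J$ of $B$ and $J'$ of $C$ with $f^{-1}(J)=g^{-1}(J')$, the bi-amalgamated algebra of $A$ with $(B,C)$ along $(J,J')$ with respect to $(f,g)$ is the subring of $B\times C$ given by $A\bowtie^{f,g}(J,J'):=\{(f(a)+j,\,g(a)+j')\mid a\in A,\ (j,j')\in J\times J'\}$. Here $f(A)+J$ is regarded as a subring of $B$ and $g(A)+J'$ as a subring of $C$. *)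

(* Defs.v *)
From HB Require Import structures.
From mathcomp Require Import all_boot all_algebra.
From mathcomp Require Import boolp classical_sets.

Set Implicit Arguments.
Unset Strict Implicit.
Unset Printing Implicit Defensive.

Import GRing.Theory.
Local Open Scope ring_scope.
Local Open Scope classical_set_scope.

(* Rings are [comPzRingType], so the zero ring is allowed.  MathComp's [idealr]
   is not used because it only covers proper ideals of nonzero rings, whereas
   here an ideal may be the whole ring. *)
Definition is_ideal (R : comPzRingType) (I : set R) : Prop :=
  [/\ I 0, forall x y, I x -> I y -> I (x + y) & forall a x, I x -> I (a * x)].

Record ideal (R : comPzRingType) := Ideal {
  ideal_set :> set R;
  idealP : is_ideal ideal_set
}.

Definition nilpotent (R : comPzRingType) (x : R) : Prop :=
  exists n : nat, x ^+ n = 0.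

Definition nil_ideal (R : comPzRingType) (I : ideal R) : Prop :=
  forall x, ideal_set I x -> nilpotent x.

Definition finitely_generated (R : comPzRingType) (I : ideal R) : Prop :=
  exists (n : nat) (u : 'I_n -> R),
    ideal_set I = [set x | exists c : 'I_n -> R, x = \sum_(i < n) c i * u i].

Definition nil_noetherian (R : comPzRingType) : Prop :=
  forall I : ideal R, nil_ideal I -> finitely_generated I.

Section IdealTheory.
Variables (R : comPzRingType) (I : ideal R).

Lemma ideal0 : ideal_set I 0. Proof. by case: (idealP I). Qed.

Lemma idealD x y : ideal_set I x -> ideal_set I y -> ideal_set I (x + y).
Proof. by case: (idealP I) => _ + _; apply. Qed.

Lemma idealMl a x : ideal_set I x -> ideal_set I (a * x).
Proof. by case: (idealP I) => _ _; apply. Qed.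

Lemma idealMr a x : ideal_set I x -> ideal_set I (x * a).
Proof. by rewrite mulrC; apply: idealMl. Qed.

Lemma idealB x y : ideal_set I x -> ideal_set I y -> ideal_set I (x - y).
Proof. by move=> Ix Iy; apply: idealD => //; rewrite -mulN1r; apply: idealMl. Qed.

End IdealTheory.

Section Preimage.
Variables (A B : comPzRingType) (f : {rmorphism A -> B}) (J : ideal B).

Lemma preimage_is_ideal : is_ideal (f @^-1` J).
Proof.
split=> [|x y|a x] /=; first by rewrite rmorph0; apply: ideal0.
- by rewrite rmorphD; apply: idealD.
- by rewrite rmorphM; apply: idealMl.
Qed.

Definition preimage_ideal : ideal A := Ideal preimage_is_ideal.

End Preimage.

Section ImagePlusIdeal.
Variables (A B : comPzRingType) (f : {rmorphism A -> B}) (J : ideal B).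

Definition image_plus_set : set B :=
  [set b | exists a j, ideal_set J j /\ b = f a + j].

Definition image_plus_pred : {pred B} := fun b => `[< image_plus_set b >].

Lemma image_plus_subring_closed : subring_closed image_plus_pred.
Proof.
split=> [|x y|x y].
- apply/asboolP; exists 1, 0; split; first exact: ideal0.
  by rewrite rmorph1 addr0.
- move=> /asboolP[a [j [Jj ->]]] /asboolP[b [k [Jk ->]]]; apply/asboolP.
  exists (a - b), (j - k); split; first exact: idealB.
  by rewrite rmorphB opprD addrACA.
- move=> /asboolP[a [j [Jj ->]]] /asboolP[b [k [Jk ->]]]; apply/asboolP.
  exists (a * b), (f a * k + j * (f b + k)); split.
    by apply: idealD; [apply: idealMl | apply: idealMr].
  by rewrite rmorphM mulrDl mulrDr addrA.
Qed.

HB.instance Definition _ :=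
  GRing.isSubringClosed.Build B image_plus_pred image_plus_subring_closed.

Definition image_plus := {b : B | b \in image_plus_pred}.

HB.instance Definition _ := SubChoice.on image_plus.
HB.instance Definition _ :=
  GRing.SubChoice_isSubComPzRing.Build B image_plus_pred image_plus
    (subringClosedP image_plus_pred).

End ImagePlusIdeal.

(* The subring of B * C underlying the bi-amalgamated algebra.  Being a subring
   does not depend on f^-1(J) = g^-1(J'), which is therefore left to the
   statements that use it. *)
Section BiAmalgamation.
Variables (A B C : comPzRingType).
Variables (f : {rmorphism A -> B}) (g : {rmorphism A -> C}).
Variables (J : ideal B) (J' : ideal C).

Definition biamalg_set : set (B * C)%type :=
  [set x | exists a j j', [/\ ideal_set J j, ideal_set J' j' & x = (f a + j, g a + j')]].

Definition biamalg_pred : {pred (B * C)%type} := fun x => `[< biamalg_set x >].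

Lemma biamalg_subring_closed : subring_closed biamalg_pred.
Proof.
split=> [|x y|x y].
- apply/asboolP; exists 1, 0, 0; split; [exact: ideal0 | exact: ideal0 |].
  by rewrite !rmorph1 !addr0.
- move=> /asboolP[a [j [j' [Jj Jj' ->]]]] /asboolP[b [k [k' [Jk Jk' ->]]]].
  apply/asboolP; exists (a - b), (j - k), (j' - k').
  split; [exact: idealB | exact: idealB |].
  by rewrite !rmorphB addrACA -opprD (addrACA (g a)) -opprD.
- move=> /asboolP[a [j [j' [Jj Jj' ->]]]] /asboolP[b [k [k' [Jk Jk' ->]]]].
  apply/asboolP; exists (a * b).
  exists (f a * k + j * (f b + k)), (g a * k' + j' * (g b + k')); split.
  + by apply: idealD; [apply: idealMl | apply: idealMr].
  + by apply: idealD; [apply: idealMl | apply: idealMr].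
  + by rewrite !rmorphM !addrA -!mulrDr -!mulrDl.
Qed.

HB.instance Definition _ :=
  GRing.isSubringClosed.Build (B * C)%type biamalg_pred biamalg_subring_closed.

Definition biamalg := {x : (B * C)%type | x \in biamalg_pred}.

HB.instance Definition _ := SubChoice.on biamalg.
HB.instance Definition _ :=
  GRing.SubChoice_isSubComPzRing.Build (B * C)%type biamalg_pred biamalg
    (subringClosedP biamalg_pred).

End BiAmalgamation.

(* Main.v *)
Require Import Defs.
From HB Require Import structures.
From mathcomp Require Import all_boot all_algebra.
From mathcomp Require Import boolp classical_sets.

Local Open Scope ring_scope.
Local Open Scope classical_set_scope.

(** The bi-amalgamation [R] is a fibre product of [S = f(A) + J] and
    [T = g(A) + J'] over [A / I_0], so the two projections [R -> S] and
    [R -> T] are surjective and an element killed by both is zero.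

    If [S] and [T] are Nil_*-Noetherian and [K] is a nil ideal of [R], then the
    image of [K] in [S] is a finitely generated nil ideal, and the elements of
    [K] killed by [R -> S] form an ideal that embeds in [T] as a nil ideal,
    hence is finitely generated too; so [K] is an extension of two finitely
    generated pieces ([nil_noetherian_subdirect]).

    Conversely the property descends along a surjection [p : R -> S] as soon as
    nilpotents of [S] lift to nilpotents of [R]: a nil ideal [K] of [S] is then
    the image of the nil ideal of nilpotent elements of [p^-1(K)]
    ([nil_noetherian_lift]).  Nilpotents do lift here because [I_0] is nil: if
    [f a + j] is nilpotent then some [f a ^+ n] lies in [J], so [a ^+ n] lies in
    [I_0], hence [a] is nilpotent and [(f a + j, g a)] is a nilpotent lift. *)

Set Implicit Arguments.
Unset Strict Implicit.
Unset Printing Implicit Defensive.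

Import GRing.Theory.

(** * Nilpotent elements *)

Lemma nilpotentMl (R : comPzRingType) (a x : R) :
  nilpotent x -> nilpotent (a * x).
Proof. by case=> n xn0; exists n; rewrite exprMn xn0 mulr0. Qed.

Lemma nilpotentD (R : comPzRingType) (x y : R) :
  nilpotent x -> nilpotent y -> nilpotent (x + y).
Proof.
case=> m xm0 [n yn0]; exists (m + n)%N.
(* In each term of the binomial expansion, x has exponent at least m or y has
   exponent at least n. *)
rewrite exprDn big1 // => i _.
have [le_ni|lt_in] := leqP n i.
  by rewrite -(subnK le_ni) (exprD y) yn0 !mulr0 mul0rn.
by rewrite -addnBA ?(ltnW lt_in) // exprD xm0 !mul0r mul0rn.
Qed.

Lemma nilpotent_rmorph (R S : comPzRingType) (p : {rmorphism R -> S}) (x : R) :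
  nilpotent x -> nilpotent (p x).
Proof. by case=> n xn0; exists n; rewrite -rmorphXn xn0 rmorph0. Qed.

Lemma nilpotent_inj (R S : comPzRingType) (p : {rmorphism R -> S}) (x : R) :
  injective p -> nilpotent (p x) -> nilpotent x.
Proof.
by move=> p_inj [n pxn0]; exists n; apply: p_inj; rewrite rmorphXn pxn0 rmorph0.
Qed.

Lemma nilpotent_pair (R S : comPzRingType) (x : R) (y : S) :
  nilpotent x -> nilpotent y -> nilpotent (x, y).
Proof.
case=> m xm0 [n yn0]; exists (m + n)%N.
have -> k : (x, y) ^+ k = (x ^+ k, y ^+ k).
  by elim: k => [|k IHk] //; rewrite !exprS IHk.
by rewrite !exprD xm0 yn0 mul0r mulr0.
Qed.

Lemma nilpotent_expl (R : comPzRingType) (x : R) n :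
  nilpotent (x ^+ n) -> nilpotent x.
Proof. by case=> m; rewrite -exprM; exists (n * m)%N. Qed.

(** * Finitely generated ideals and ring homomorphisms *)

Lemma ideal_sum (R : comPzRingType) (I : ideal R) n (c u : 'I_n -> R) :
  (forall i, ideal_set I (u i)) -> ideal_set I (\sum_(i < n) c i * u i).
Proof.
move=> Iu; apply: big_ind => [|x y|i _]; first exact: ideal0.
  exact: idealD.
exact: idealMl.
Qed.

Lemma fg_generator (R : comPzRingType) (I : ideal R) n (u : 'I_n -> R) :
  ideal_set I = [set x | exists c : 'I_n -> R, x = \sum_(i < n) c i * u i] ->
  forall i, ideal_set I (u i).
Proof.
move=> ->; move=> i; exists (fun k => (k == i)%:R).
rewrite (bigD1 i) //= eqxx mul1r big1 ?addr0 // => k /negPf->.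
by rewrite mul0r.
Qed.

Section Surjection.
Variables (R S : comPzRingType) (p : {rmorphism R -> S}).
Hypothesis p_surj : forall s, exists r, p r = s.

Lemma image_is_ideal (K : ideal R) : is_ideal (p @` ideal_set K).
Proof.
split=> [|_ _ [x Kx <-] [y Ky <-]|a _ [x Kx <-]].
- by exists 0; [exact: ideal0 | exact: rmorph0].
- by exists (x + y); [exact: idealD | exact: rmorphD].
- have [r <-] := p_surj a.
  by exists (r * x); [exact: idealMl | exact: rmorphM].
Qed.

Definition image_ideal (K : ideal R) : ideal S := Ideal (image_is_ideal K).

Lemma image_nil_ideal (K : ideal R) :
  nil_ideal K -> nil_ideal (image_ideal K).
Proof. by move=> Knil _ [x Kx <-]; apply: nilpotent_rmorph; apply: Knil. Qed.

Lemma fg_image (K : ideal R) :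
  finitely_generated K -> finitely_generated (image_ideal K).
Proof.
case=> n [u Ku]; exists n, (fun i => p (u i)); apply/seteqP; split=> [s|s [c ->]].
- case=> x; rewrite Ku => -[c ->] <-; exists (fun i => p (c i)).
  by rewrite rmorph_sum; apply: eq_bigr => i _; rewrite rmorphM.
- apply: (@ideal_sum _ (image_ideal K)) => i.
  by exists (u i) => //; apply: fg_generator Ku i.
Qed.

Lemma kernel_part_is_ideal (K : ideal R) :
  is_ideal [set x | ideal_set K x /\ p x = 0].
Proof.
split=> [|x y [Kx px0] [Ky py0]|a x [Kx px0]] /=.
- by split; [exact: ideal0 | exact: rmorph0].
- by split; [exact: idealD | rewrite rmorphD px0 py0 addr0].
- by split; [exact: idealMl | rewrite rmorphM px0 mulr0].
Qed.

Definition kernel_part (K : ideal R) : ideal R := Ideal (kernel_part_is_ideal K).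

(** Lifts of generators of the image, together with generators of the part of
    [K] in the kernel, generate [K]. *)
Lemma fg_extension (K : ideal R) :
  finitely_generated (image_ideal K) -> finitely_generated (kernel_part K) ->
  finitely_generated K.
Proof.
case=> m [u imK] [n [w kerK]].
have /choice[v Kv] i : exists r, ideal_set K r /\ p r = u i.
  by have [r Kr pr] := fg_generator imK i; exists r.
have Kw i : ideal_set K (w i) by have [] := fg_generator kerK i.
pose t (i : 'I_(m + n)) :=
  match split i with inl k => v k | inr k => w k end.
have tl k : t (lshift n k) = v k by rewrite /t (unsplitK (inl k)).
have tr k : t (rshift m k) = w k by rewrite /t (unsplitK (inr k)).
exists (m + n)%N, t; apply/seteqP; split=> [x Kx|x [c ->]]; last first.
  apply: ideal_sum => i; rewrite /t; case: (split i) => k //.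
  by have [] := Kv k.
have : ideal_set (image_ideal K) (p x) by exists x.
rewrite imK => -[c px]; have /choice[d dE] i := p_surj (c i).
have : ideal_set (kernel_part K) (x - \sum_(i < m) d i * v i).
  split; first by apply: idealB => //; apply: ideal_sum => i; have [] := Kv i.
  rewrite rmorphB rmorph_sum px; apply/eqP; rewrite subr_eq0; apply/eqP.
  by apply: eq_bigr => i _; rewrite rmorphM dE; have [_ ->] := Kv i.
rewrite kerK => -[e xE].
exists (fun i => match split i with inl k => d k | inr k => e k end).
rewrite big_split_ord /=.
under eq_bigr do rewrite tl (unsplitK (inl _)).
under [X in _ + X]eq_bigr do rewrite tr (unsplitK (inr _)).
by rewrite -xE addrC subrK.
Qed.

Lemma nilpotent_part_is_ideal (K : ideal S) :
  is_ideal [set x | ideal_set K (p x) /\ nilpotent x].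
Proof.
split=> [|x y [Kx xnil] [Ky ynil]|a x [Kx xnil]] /=.
- by split; [rewrite rmorph0; exact: ideal0 | exists 1%N; rewrite expr1].
- by split; [rewrite rmorphD; exact: idealD | exact: nilpotentD].
- by split; [rewrite rmorphM; exact: idealMl | exact: nilpotentMl].
Qed.

(** A nil ideal of [S] may have a non-nil preimage, since the kernel of [p] need
    not be nil; this is why the preimage is cut down to its nilpotent elements,
    which still surject onto the ideal when nilpotents lift. *)
Lemma nil_noetherian_lift :
  (forall s, nilpotent s -> exists2 r, nilpotent r & p r = s) ->
  nil_noetherian R -> nil_noetherian S.
Proof.
move=> lift noethR K Knil; pose N := Ideal (nilpotent_part_is_ideal K).
have Nfg : finitely_generated N by apply: noethR => x [].
have [n [u imN]] := fg_image Nfg; exists n, u; rewrite -imN.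
apply/seteqP; split=> [s Ks|_ [x [Kx _] <-] //].
by have [r rnil pr] := lift s (Knil s Ks); exists r; rewrite ?pr //; split; rewrite ?pr.
Qed.

End Surjection.

(** * Subdirect products *)

(** On the elements killed by [p], the map [q] is injective, so two uses of
    [fg_extension] leave only the zero ideal. *)
Lemma nil_noetherian_subdirect (R S T : comPzRingType)
    (p : {rmorphism R -> S}) (q : {rmorphism R -> T}) :
  (forall s, exists r, p r = s) -> (forall t, exists r, q r = t) ->
  (forall x, p x = 0 -> q x = 0 -> x = 0) ->
  nil_noetherian S -> nil_noetherian T -> nil_noetherian R.
Proof.
move=> p_surj q_surj pq_inj noethS noethT K Knil.
apply: (fg_extension (p_surj := p_surj)).
  by apply: noethS; apply: image_nil_ideal.
apply: (fg_extension (p_surj := q_surj)).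
  by apply: noethT; apply: image_nil_ideal => x [Kx _]; apply: Knil.
(* What is left of K is killed by p and q, hence zero: no generator is needed. *)
exists 0%N, (fun=> 0); apply/seteqP; split=> [x [[_ px0] qx0]|x [c ->]].
  by exists (fun=> 0); rewrite big_ord0; apply: pq_inj.
by rewrite big_ord0; apply: ideal0.
Qed.

(** * Projections of the bi-amalgamation *)

(** Modulo [J], the power [(f a + j) ^+ n] is [f (a ^+ n)]. *)
Lemma nilpotent_image_plus (A B : comPzRingType) (f : {rmorphism A -> B})
    (J : ideal B) a j :
  nil_ideal (preimage_ideal f J) -> ideal_set J j -> nilpotent (f a + j) ->
  nilpotent a.
Proof.
move=> I0nil Jj [n ajn0]; apply: (@nilpotent_expl _ a n); apply: I0nil.
have -> : ideal_set (preimage_ideal f J) (a ^+ n) = ideal_set J (f a ^+ n).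
  by rewrite /= rmorphXn.
have -> : f a ^+ n = f a ^+ n - (f a + j) ^+ n by rewrite ajn0 subr0.
rewrite subrXX opprD addrA subrr add0r mulrC.
by apply: idealMl; rewrite -sub0r; apply: idealB => //; exact: ideal0.
Qed.

Section Projections.
Variables (A B C : comPzRingType).
Variables (f : {rmorphism A -> B}) (g : {rmorphism A -> C}).
Variables (J : ideal B) (J' : ideal C).

Lemma biamalg_fst_subproof (x : biamalg f g J J') :
  (val x).1 \in image_plus_pred f J.
Proof.
case: x => x /= /asboolP[a [j [j' [Jj _ ->]]]].
by apply/asboolP; exists a, j.
Qed.

Definition biamalg_fst (x : biamalg f g J J') : image_plus f J :=
  Sub (val x).1 (biamalg_fst_subproof x).

Lemma biamalg_fst_is_zmod_morphism : zmod_morphism biamalg_fst.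
Proof. by move=> x y; apply: val_inj. Qed.

Lemma biamalg_fst_is_monoid_morphism : monoid_morphism biamalg_fst.
Proof. by split=> [|x y]; apply: val_inj. Qed.

HB.instance Definition _ :=
  GRing.isZmodMorphism.Build _ _ biamalg_fst biamalg_fst_is_zmod_morphism.
HB.instance Definition _ :=
  GRing.isMonoidMorphism.Build _ _ biamalg_fst biamalg_fst_is_monoid_morphism.

Lemma biamalg_snd_subproof (x : biamalg f g J J') :
  (val x).2 \in image_plus_pred g J'.
Proof.
case: x => x /= /asboolP[a [j [j' [_ Jj' ->]]]].
by apply/asboolP; exists a, j'.
Qed.

Definition biamalg_snd (x : biamalg f g J J') : image_plus g J' :=
  Sub (val x).2 (biamalg_snd_subproof x).

Lemma biamalg_snd_is_zmod_morphism : zmod_morphism biamalg_snd.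
Proof. by move=> x y; apply: val_inj. Qed.

Lemma biamalg_snd_is_monoid_morphism : monoid_morphism biamalg_snd.
Proof. by split=> [|x y]; apply: val_inj. Qed.

HB.instance Definition _ :=
  GRing.isZmodMorphism.Build _ _ biamalg_snd biamalg_snd_is_zmod_morphism.
HB.instance Definition _ :=
  GRing.isMonoidMorphism.Build _ _ biamalg_snd biamalg_snd_is_monoid_morphism.

Lemma biamalg_elt a j j' : ideal_set J j -> ideal_set J' j' ->
  (f a + j, g a + j') \in biamalg_pred f g J J'.
Proof. by move=> Jj Jj'; apply/asboolP; exists a, j, j'. Qed.

Lemma biamalg_fst_surj s : exists r, biamalg_fst r = s.
Proof.
case: s => s s_in; have /asboolP[a [j [Jj sE]]] := s_in.
exists (Sub (f a + j, g a + 0) (biamalg_elt a Jj (ideal0 J'))).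
exact: val_inj.
Qed.

Lemma biamalg_snd_surj t : exists r, biamalg_snd r = t.
Proof.
case: t => t t_in; have /asboolP[a [j' [Jj' tE]]] := t_in.
exists (Sub (f a + 0, g a + j') (biamalg_elt a (ideal0 J) Jj')).
exact: val_inj.
Qed.

Lemma biamalg_proj_inj x : biamalg_fst x = 0 -> biamalg_snd x = 0 -> x = 0.
Proof.
move=> /(congr1 val) /= x1 /(congr1 val) /= x2; apply: val_inj.
by rewrite /= [LHS]surjective_pairing x1 x2.
Qed.

(** The lift is [(f a + j, g a)]: its second component is nilpotent because [a]
    itself is. *)
Lemma biamalg_fst_nil_lift (s : image_plus f J) :
  nil_ideal (preimage_ideal f J) -> nilpotent s ->
  exists2 r, nilpotent r & biamalg_fst r = s.
Proof.
move=> I0nil snil; have /asboolP[a [j [Jj sE]]] := valP s.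
have ajnil : nilpotent (f a + j) by rewrite -sE; apply: nilpotent_rmorph.
exists (Sub (f a + j, g a + 0) (biamalg_elt a Jj (ideal0 J'))); last by apply: val_inj.
apply: (nilpotent_inj (p := val)); first exact: val_inj.
apply: nilpotent_pair => //; rewrite addr0; apply: nilpotent_rmorph.
exact: nilpotent_image_plus I0nil Jj ajnil.
Qed.

Lemma biamalg_snd_nil_lift (t : image_plus g J') :
  nil_ideal (preimage_ideal g J') -> nilpotent t ->
  exists2 r, nilpotent r & biamalg_snd r = t.
Proof.
move=> I0nil tnil; have /asboolP[a [j' [Jj' tE]]] := valP t.
have ajnil : nilpotent (g a + j') by rewrite -tE; apply: nilpotent_rmorph.
exists (Sub (f a + 0, g a + j') (biamalg_elt a (ideal0 J) Jj')); last by apply: val_inj.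
apply: (nilpotent_inj (p := val)); first exact: val_inj.
apply: nilpotent_pair => //; rewrite addr0; apply: nilpotent_rmorph.
exact: nilpotent_image_plus I0nil Jj' ajnil.
Qed.

End Projections.

Theorem proposition2p7 (A B C : comPzRingType)
    (f : {rmorphism A -> B}) (g : {rmorphism A -> C})
    (J : ideal B) (J' : ideal C)
    (hJJ' : f @^-1` J = g @^-1` J')
    (hI0 : nil_ideal (preimage_ideal f J)) :
  nil_noetherian (biamalg f g J J') <->
  nil_noetherian (image_plus f J) /\ nil_noetherian (image_plus g J').
Proof.
have hI0' : nil_ideal (preimage_ideal g J').
  by move=> a; rewrite /= -[ideal_set J' _]/((g @^-1` J') a) -hJJ'; apply: hI0.
split=> [noethR|[noethS noethT]].
  split.
    apply: (nil_noetherian_lift (@biamalg_fst_surj _ _ _ f g J J')) noethR.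
    by move=> s; apply: biamalg_fst_nil_lift.
  apply: (nil_noetherian_lift (@biamalg_snd_surj _ _ _ f g J J')) noethR.
  by move=> t; apply: biamalg_snd_nil_lift.
exact: (nil_noetherian_subdirect (@biamalg_fst_surj _ _ _ f g J J')
  (@biamalg_snd_surj _ _ _ f g J J') (@biamalg_proj_inj _ _ _ f g J J')).
Qed.
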